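(* Let $(X,\mathcal{B},\mu)$ be a standard probability space and let $1\le p<\infty$. Then there exists $f\in L^p_0$ such that for any $T\in\mathcal{E}$ and any measurable $g:X\to\mathbb{R}$ with $f=g-g\circ T$ a.e., one has $g\notin L^q$ for every $q>p-1$. More generally, there exists a dense $G_\delta$ set $\mathcal{G}_p\subset L^p_0$ (with respect to the $L^p$-norm topology) such that for any $f\in\mathcal{G}_p$, and any $T\in\mathcal{E}$ and measurable $g$ with $f=g-g\circ T$ a.e., one has $g\notin L^q$ for every $q>p-1$.
   Context: A standard probability space here means one isomorphic to $[0,1]$ with Lebesgue measure. For $0<q<\infty$, $L^q=\{h:X\to\mathbb{R}\ :\ h \text{ measurable and } \int_X |h|^q\,d\mu<\infty\}$ (including $0<q<1$). For $1\le p<\infty$, $L^p_0=\{f\in L^p:\int_X f\,d\mu=0\}$. $\mathcal{E}$ is the family of ergodic invertible measure preserving transformations of $(X,\mathcal{B},\mu)$. *)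

(* Defs.v *)
(* Uses Mathematical Components and MathComp-Analysis. *)
From HB Require Import structures.
From mathcomp Require Import all_boot all_order all_algebra.
From mathcomp Require Import all_classical all_reals all_analysis.
From mathcomp Require Import borel_hierarchy.

Set Implicit Arguments.
Unset Strict Implicit.
Unset Printing Implicit Defensive.

Import Order.TTheory GRing.Theory Num.Theory.
Import numFieldNormedType.Exports.

Local Open Scope classical_set_scope.
Local Open Scope ring_scope.

(* [LfunType mu p1] consists of genuine functions, not of classes modulo almost
   everywhere equality, so this pseudometric is not separated.  Its open sets
   are saturated for almost everywhere equality, and hence correspond to the
   open sets of the normed quotient space. *)
Section Lp_topology.
Context d (X : measurableType d) (R : realType).
Variables (mu : {measure set X -> \bar R}) (p : \bar R) (p1 : (1 <= p)%E).
Implicit Types f g h : LfunType mu p1.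

Definition Lp_ball f (e : R) g : Prop :=
  ('N[mu]_p[(fun x => (f x - g x)%:E)] < e%:E)%E.

Lemma Lp_ball_center f (e : R) : 0 < e -> Lp_ball f e f.
Proof.
move=> e0; rewrite /Lp_ball (_ : (fun _ => _) = cst 0%E).
  by rewrite Lnorm0 ?lte_fin// gt_eqF// (lt_le_trans _ p1).
by apply/funext => x /=; rewrite subrr.
Qed.

Lemma Lp_ball_sym f g (e : R) : Lp_ball f e g -> Lp_ball g e f.
Proof.
rewrite /Lp_ball -oppe_Lnorm; congr (Lnorm _ _ _ < _)%E.
by apply/funext => x /=; rewrite -[in RHS]opprB.
Qed.

Lemma Lp_ball_triangle f g h (e1 e2 : R) :
  Lp_ball f e1 g -> Lp_ball g e2 h -> Lp_ball f (e1 + e2) h.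
Proof.
rewrite /Lp_ball => fg gh.
rewrite (_ : (fun _ => (_ - h _)%:E) =
    EFin \o (((f : X -> R) \- g) \+ ((g : X -> R) \- h))); last first.
  by apply/funext => x /=; rewrite addrA subrK.
apply: le_lt_trans (eminkowski mu _ _ p1) _.
- exact: measurable_realfun.measurable_funB.
- exact: measurable_realfun.measurable_funB.
- by rewrite EFinD lteD.
Qed.

HB.instance Definition _ := hasNbhs.Build (LfunType mu p1)
  (nbhs_ (entourage_ Lp_ball)).
HB.instance Definition _ := Nbhs_isPseudoMetric.Build R (LfunType mu p1)
  erefl Lp_ball_center Lp_ball_sym Lp_ball_triangle erefl.

End Lp_topology.

Section Function_spaces.
Context d (X : measurableType d) (R : realType).
Variable mu : {measure set X -> \bar R}.

Definition Lp0 (p : \bar R) (p1 : (1 <= p)%E) : set (LfunType mu p1) :=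
  [set f | (\int[mu]_x (f x)%:E = 0)%E].

Definition Lq (q : R) : set (X -> R) :=
  [set h : X -> R | measurable_fun setT h /\ (\int[mu]_x (`|h x| `^ q)%:E < +oo)%E].

Lemma LqE (q : R) (h : X -> R) : 0 < q -> Lq q h <-> h \in Lfun mu q%:E.
Proof.
move=> q0.
have E : (\int[mu]_x (`|h x| `^ q)%:E < +oo)%E <-> finite_norm mu q%:E h.
  rewrite /finite_norm unlock /=; split; first exact: poweR_lty.
  by apply: lty_poweRy; rewrite invr_eq0 gt_eqF.
split=> [[mh /E fh]|/andP[]]; first by apply/andP; rewrite !inE.
by rewrite !inE => mh fh; split => //; exact/E.
Qed.

End Function_spaces.

Arguments Lp0 {d X R} mu {p} p1.

(* Isomorphism modulo null sets between the measure space [mu] and the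
   restriction of [nu] to [D]. *)
Definition iso_mod0 (R : realType) d1 d2
    (X : measurableType d1) (Y : measurableType d2)
    (mu : {measure set X -> \bar R}) (nu : {measure set Y -> \bar R})
    (D : set Y) : Prop :=
  exists (X0 : set X) (Y0 : set Y) (phi : X -> Y) (psi : Y -> X),
    [/\ measurable X0, mu (~` X0) = 0%E, measurable Y0, Y0 `<=` D
      & nu (D `\` Y0) = 0%E] /\
    [/\ set_fun X0 Y0 phi, set_fun Y0 X0 psi,
        {in X0, cancel phi psi} & {in Y0, cancel psi phi}] /\
    [/\ measurable_fun X0 phi, measurable_fun Y0 psi
      & forall B, measurable B -> B `<=` Y0 ->
          mu (X0 `&` phi @^-1` B) = nu B].

(* The two cases are Lebesgue measure on the Borel sets and on the Lebesgue
   measurable sets of [0, 1]: a standard probability space may or may not be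
   complete, depending on the convention. *)
Definition standard_probability_space (R : realType) d (X : measurableType d)
    (mu : probability X R) : Prop :=
  iso_mod0 mu (@lebesgue_measure R) `[0, 1] \/
  iso_mod0 mu (@completed_lebesgue_measure R) `[0, 1].

Section Transformations.
Context d (X : measurableType d) (R : realType).
Variable mu : probability X R.
Implicit Type T : X -> X.

Definition measure_preserving T : Prop :=
  measurable_fun setT T /\
  forall A, measurable A -> mu (T @^-1` A) = mu A.

Definition invertible_mod0 T : Prop :=
  exists S : X -> X, [/\ measurable_fun setT S,
    {ae mu, forall x, S (T x) = x} & {ae mu, forall x, T (S x) = x}].

Definition ergodic T : Prop :=
  forall A, measurable A -> T @^-1` A = A -> mu A = 0%E \/ mu A = 1%E.

Definition ergodic_automorphism : set (X -> X) :=
  [set T | [/\ measure_preserving T, invertible_mod0 T & ergodic T]].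

Definition no_integrable_transfer (p : R) (f : X -> R) : Prop :=
  forall T, ergodic_automorphism T ->
  forall g : X -> R, measurable_fun setT g ->
    {ae mu, forall x, f x = g x - g (T x)} ->
  forall q : R, p - 1 < q -> ~ Lq mu q g.

End Transformations.

(* Main.v *)
Require Import Defs.
From HB Require Import structures.
From mathcomp Require Import all_boot all_order all_algebra.
From mathcomp Require Import all_classical all_reals all_analysis.
From mathcomp Require Import borel_hierarchy measurable_realfun ring lra.

(* Let [h >= - B] and [h = g - g \o T] with [T] measure preserving.  Integrating
   [Phi (g) - Phi (g \o T)], where [Phi a = a * |a| ^ q], gives [0]; where
   [h > 0] the integrand is at least [(h / 2) ^ (q + 1)], while where [h <= 0]
   it is at least [- C * (|g| ^ q + 1)] because [g] then increases by at most
   [B].  So [g] in [L^q] would put the positive part of [h] in [L^(q + 1)].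
   Truncating [Phi] makes the integrals legitimate, and also makes the argument
   stable: for a given bound on the integral of [|g| ^ q], it still excludes all
   functions in a small [L^p] ball around [h].
   The functions [h] that are bounded below and whose positive part is in no
   [L^r], [r > p], are dense in [L^p_0]; they lie in every [large_transfer n],
   and even in its interior.  The intersection of these interiors is thus a
   dense G_delta set, without any appeal to Baire's theorem. *)

Set Implicit Arguments.
Unset Strict Implicit.
Unset Printing Implicit Defensive.

Import Order.TTheory GRing.Theory Num.Theory.
Import numFieldNormedType.Exports.

Local Open Scope classical_set_scope.
Local Open Scope ring_scope.

(** * A truncated signed power *)

Section Signed_power.
Context {R : realType}.
Implicit Types a b h q x y K L N : R.

Lemma ler_powRl q x y : 0 < q -> 0 <= x -> x <= y -> x `^ q <= y `^ q.
Proof.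
move=> q0 x0 xy; apply: ge0_ler_powR => //; first exact: ltW.
exact: le_trans xy.
Qed.

Lemma powR_addn1 q x : 0 < q -> 0 <= x -> x `^ (q + 1) = x * x `^ q.
Proof.
by move=> q0 x0; rewrite -{2}(addrK 1 q) mulr_powRB1// addr_gt0.
Qed.

Lemma powRD_le q x y : 0 < q -> 0 <= x -> 0 <= y ->
  (x + y) `^ q <= 2 `^ q * (x `^ q + y `^ q).
Proof.
move=> q0; wlog xy : x y / x <= y.
  move=> wlg x0 y0; have [xy|/ltW yx] := leP x y; first exact: wlg.
  by rewrite addrC [_ `^ _ + _]addrC wlg.
move=> x0 y0; apply: (@le_trans _ _ ((2 * y) `^ q)).
  by apply: ler_powRl => //; lra.
by rewrite powRM// ler_wpM2l ?powR_ge0// lerDr powR_ge0.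
Qed.

(** Bernoulli's inequality. The induction step adds (1 - t) * (1 - t ^ n) >= 0, whose factors have
    the same sign. *)
Lemma bernoulli_sub (n : nat) (t : R) : 0 <= t -> 1 - t ^+ n <= n%:R * (1 - t).
Proof.
move=> t0; elim: n => [|n IH]; first by rewrite expr0 mul0r subrr.
have tn : 0 <= t ^+ n by exact: exprn_ge0.
have : 0 <= (1 - t) * (1 - t ^+ n).
  have [t1|/ltW t1] := leP t 1.
    by rewrite mulr_ge0 ?subr_ge0// exprn_ile1.
  by rewrite mulr_le0 ?subr_le0// exprn_ege1.
by rewrite exprS -natr1; nra.
Qed.

(** An integer above q + 1, the constant in the derivative of x ^ (q + 1); being an integer, it is
    accessible to [bernoulli_sub]. *)
Definition lip_cst q : R := (Num.truncn q).+2%:R.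

Lemma lip_cst_ge1 q : 1 <= lip_cst q.
Proof. by rewrite ler1n. Qed.

(** By homogeneity everything reduces to t = y / x in [0, 1]. There t ^ q is at least t ^ m for an
    integer m > q, and Bernoulli's inequality applies to t ^ m. *)
Lemma mulr_powR_lip q x y : 0 < q -> 0 <= y -> y <= x ->
  x * x `^ q - y * y `^ q <= lip_cst q * x `^ q * (x - y).
Proof.
move=> q0 y0 yx; have x0 : 0 <= x by lra.
have [->|xn0] := eqVneq x 0.
  by rewrite powR0 ?gt_eqF// !(mul0r, mulr0) sub0r oppr_le0 mulr_ge0 ?powR_ge0.
have {}x0 : 0 < x by rewrite lt_def xn0.
pose t := y / x.
have t0 : 0 <= t by rewrite divr_ge0// ltW.
have t1 : t <= 1 by rewrite ler_pdivrMr ?mul1r.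
have yE : y = t * x by rewrite /t divfK ?gt_eqF.
have q1 : 1 - t `^ q <= (Num.truncn q).+1%:R * (1 - t).
  have [->|tn0] := eqVneq t 0.
    by rewrite powR0 ?gt_eqF// subr0 mulr1 ler1n.
  have t0' : 0 < t by rewrite lt_def tn0.
  apply: le_trans (bernoulli_sub _ t0).
  rewrite lerD2l lerN2 -powR_mulrn// ger_powR ?t0'// ltW//.
  exact: truncnS_gt.
rewrite yE powRM// ?(ltW x0)//.
have : 0 <= x * x `^ q by rewrite mulr_ge0 ?powR_ge0// ltW.
have : 1 - t * t `^ q <= lip_cst q * (1 - t).
  rewrite /lip_cst -natr1.
  set m := _.+1%:R in q1 *.
  have : 0 <= t `^ q by exact: powR_ge0.
  have : t `^ q <= 1 by have := ler_powRl q0 t0 t1; rewrite powR1.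
  nra.
set tq := t `^ q; set xq := x `^ q; set c := lip_cst q => H1 H2.
have -> : x * xq - t * x * (tq * xq) = (1 - t * tq) * (x * xq) by ring.
have -> : c * xq * (x - t * x) = (c * (1 - t)) * (x * xq) by ring.
exact: ler_wpM2r.
Qed.

Definition spow q a : R := a * `|a| `^ q.

Lemma spowN q a : spow q (- a) = - spow q a.
Proof. by rewrite /spow normrN mulNr. Qed.

(** Nonpositive arguments reduce to nonnegative ones by oddness. For opposite signs both powers are
    at most K ^ q, so the difference is at most K ^ q * (a - b). *)
Lemma spow_lip q K a b : 0 < q -> `|a| <= K -> `|b| <= K -> b <= a ->
  0 <= spow q a - spow q b <= lip_cst q * K `^ q * (a - b).
Proof.
move=> q0; have base x y : `|x| <= K -> `|y| <= K -> y <= x -> 0 <= y ->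
    0 <= spow q x - spow q y <= lip_cst q * K `^ q * (x - y).
  move=> xK yK yx y0; have x0 : 0 <= x by lra.
  rewrite /spow !ger0_norm//; apply/andP; split.
    by rewrite subr_ge0 ler_pM// ?powR_ge0// ler_powRl.
  apply: le_trans (mulr_powR_lip q0 y0 yx) _.
  rewrite ler_wpM2r ?subr_ge0// ler_wpM2l ?ler0n//.
  by rewrite ler_powRl//; move: xK; rewrite ger0_norm.
move=> aK bK ba; have [b0|b0] := leP 0 b; first exact: base.
have [a0|a0] := leP a 0.
  have := base (- b) (- a); rewrite !normrN !spowN !opprK.
  rewrite [- spow q b + _]addrC [- b + _]addrC; apply => //; lra.
rewrite /spow (gtr0_norm a0) (ltr0_norm b0).
rewrite (gtr0_norm a0) (ltr0_norm b0) in aK bK.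
have aq : a `^ q <= K `^ q by rewrite ler_powRl// ltW.
have bq : (- b) `^ q <= K `^ q by rewrite ler_powRl//; lra.
have aq0 : 0 <= a `^ q by exact: powR_ge0.
have bq0 : 0 <= (- b) `^ q by exact: powR_ge0.
have c1 := lip_cst_ge1 q.
set A := a `^ q in aq aq0 *; set B := (- b) `^ q in bq bq0 *.
set k := K `^ q in aq bq *; set c := lip_cst q in c1 *.
apply/andP; split; first by nra.
have : a * A - b * B <= k * (a - b) by nra.
have : 0 <= k * (a - b) by rewrite mulr_ge0//; lra.
nra.
Qed.

(** One of a and a - h has absolute value at least h / 2; the reflection x -> - x exchanges the two
    cases. *)
Lemma spow_drop q a h : 0 < q -> 0 <= h ->
  (h / 2) `^ (q + 1) <= spow q a - spow q (a - h).
Proof.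
move=> q0 h0; have h20 : 0 <= h / 2 by lra.
rewrite powR_addn1//.
have base x y : 0 <= x -> h <= 2 * x -> y = x - h ->
    h / 2 * (h / 2) `^ q <= spow q x - spow q y.
  move=> x0 hx yE; rewrite /spow (ger0_norm x0).
  have Hx : (h / 2) `^ q <= x `^ q by rewrite ler_powRl//; lra.
  have H0 : 0 <= (h / 2) `^ q by exact: powR_ge0.
  have [y0|y0] := leP y 0.
    have : 0 <= - y * `|y| `^ q by rewrite mulr_ge0 ?powR_ge0//; lra.
    have : h / 2 * (h / 2) `^ q <= x * x `^ q by rewrite ler_pM//; lra.
    lra.
  have : `|y| `^ q <= x `^ q.
    by rewrite gtr0_norm// ler_powRl//; lra.
  by rewrite (gtr0_norm y0) yE; nra.
have [ha|ah] := leP h (2 * a).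
  by apply: base => //; lra.
have := base (- (a - h)) (- a); rewrite !spowN.
rewrite opprK [- spow q _ + _]addrC; apply; lra.
Qed.

Definition clamp N a : R := Num.max (- N) (Num.min a N).

Lemma clampE N a : 0 <= N ->
  clamp N a = if a < - N then - N else if N < a then N else a.
Proof.
move=> N0; rewrite /clamp; case: (leP a N) => aN.
  by case: (leP (- N) a).
have -> : (a < - N) = false by apply/negbTE; rewrite -leNgt; lra.
by rewrite max_r//; lra.
Qed.

Lemma clamp_norm N a : 0 <= N -> `|clamp N a| <= N.
Proof.
move=> N0; rewrite clampE// ler_norml.
by case: ltP => ?; [|case: ltP => ?]; apply/andP; split; lra.
Qed.

Lemma clamp_le N a b : 0 <= N -> b <= a -> clamp N b <= clamp N a.
Proof.
move=> N0 ba; rewrite !clampE//.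
by case: (ltP b (- N)) => ?; case: (ltP a (- N)) => ?; case: (ltP N b) => ?;
  case: (ltP N a) => ?; lra.
Qed.

Lemma clamp_lip N a b : 0 <= N -> b <= a -> clamp N a - clamp N b <= a - b.
Proof.
move=> N0 ba; rewrite !clampE//.
by case: (ltP b (- N)) => ?; case: (ltP a (- N)) => ?; case: (ltP N b) => ?;
  case: (ltP N a) => ?; lra.
Qed.

Lemma clamp_id N a : `|a| <= N -> clamp N a = a.
Proof.
move=> /[dup] aN; rewrite ler_norml => /andP[? ?].
by rewrite clampE ?(le_trans _ aN)//; case: ltP => ?; [|case: ltP => ?]; lra.
Qed.

Lemma clamp_norm_le N a : 0 <= N -> `|clamp N a| <= `|a|.
Proof.
move=> N0; rewrite clampE// ler_normr.
case: ltP => ?; [|case: ltP => ?]; rewrite ?normrN ?(ger0_norm N0).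
- by apply/orP; right; lra.
- by apply/orP; left; lra.
- by case: ger0P; rewrite lexx ?orbT.
Qed.

(** Clamping makes the signed power bounded and Lipschitz while keeping it nondecreasing. *)
Definition tspow q N a : R := spow q (clamp N a).

Lemma tspow_bound q N a : 0 < q -> 0 <= N -> `|tspow q N a| <= N * N `^ q.
Proof.
move=> q0 N0; rewrite /tspow /spow normrM [`|_ `^ _|]ger0_norm ?powR_ge0//.
have H := clamp_norm a N0.
by rewrite ler_pM// ?powR_ge0// ler_powRl.
Qed.

Lemma tspow_le q N a b : 0 < q -> 0 <= N -> b <= a ->
  tspow q N b <= tspow q N a.
Proof.
move=> q0 N0 ba; rewrite -subr_ge0.
by have /andP[] := spow_lip q0 (clamp_norm a N0) (clamp_norm b N0)
  (clamp_le N0 ba).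
Qed.

Lemma tspow_lip q N a b : 0 < q -> 0 <= N ->
  `|tspow q N a - tspow q N b| <= lip_cst q * N `^ q * `|a - b|.
Proof.
move=> q0 N0; wlog ba : a b / b <= a.
  move=> wlg; have [|/ltW] := leP b a; first exact: wlg.
  by rewrite distrC [`|a - b|]distrC; exact: wlg.
rewrite !ger0_norm ?subr_ge0 ?tspow_le//.
have /andP[_] := spow_lip q0 (clamp_norm a N0) (clamp_norm b N0)
  (clamp_le N0 ba).
move=> /le_trans; apply; rewrite ler_wpM2l ?clamp_lip//.
by rewrite mulr_ge0 ?powR_ge0 ?ler0n.
Qed.

(** The bound is uniform in [N]: clamping never increases absolute values, so [spow_lip] applies
    with K = |a| + B. *)
Lemma tspow_rise q N B a v : 0 < q -> 0 <= N -> 0 <= v -> v <= B ->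
  tspow q N (a + v) - tspow q N a <=
    lip_cst q * B * 2 `^ q * (`|a| `^ q + B `^ q).
Proof.
move=> q0 N0 v0 vB; have B0 : 0 <= B by lra.
have aav : a <= a + v by lra.
have H1 : `|clamp N a| <= `|a| + B.
  by apply: le_trans (clamp_norm_le a N0) _; rewrite lerDl.
have H2 : `|clamp N (a + v)| <= `|a| + B.
  apply: le_trans (clamp_norm_le _ N0) _; apply: le_trans (ler_normD _ _) _.
  by rewrite lerD2l ger0_norm.
have /andP[_ H] := spow_lip q0 H2 H1 (clamp_le N0 aav).
apply: le_trans H _.
have c1 := lip_cst_ge1 q.
have H3 : clamp N (a + v) - clamp N a <= B.
  by apply: le_trans (clamp_lip N0 aav) _; lra.
have H4 : 0 <= clamp N (a + v) - clamp N a by rewrite subr_ge0 clamp_le.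
have H5 := powRD_le q0 (normr_ge0 a) B0.
have -> : lip_cst q * B * 2 `^ q * (`|a| `^ q + B `^ q) =
  lip_cst q * (2 `^ q * (`|a| `^ q + B `^ q)) * B by ring.
rewrite ler_pM// ?mulr_ge0 ?powR_ge0// ?ler0n//.
by rewrite ler_wpM2l// ler0n.
Qed.

(* The constant in front of [`|a| `^ q + 1] must not depend on [L] and [N]:
   [L] is chosen depending on it. *)
Lemma tspow_coboundary q B L N a b h : 0 < q -> 0 <= B -> 0 <= L -> - B <= h ->
  L `^ (q + 1) <= (N / 2) `^ q -> 2 * L <= N ->
  (Num.max 0 (Num.min h L) / 2) `^ (q + 1) + tspow q N b <=
  tspow q N a + (1 + lip_cst q * B * 2 `^ q) * (1 + B `^ q) * (`|a| `^ q + 1)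
  + lip_cst q * N `^ q * `|a - b - h|.
Proof.
move=> q0 B0 L0 hB LN NL; have N0 : 0 <= N by lra.
have aq : 0 <= `|a| `^ q by exact: powR_ge0.
have Bq : 0 <= B `^ q by exact: powR_ge0.
set C := lip_cst q * B * 2 `^ q.
have C0 : 0 <= C by rewrite !mulr_ge0 ?powR_ge0 ?ler0n.
(* The Lipschitz bound replaces [b] by [a - h]; all the dependence on the error a - b - h goes into
   [e]. *)
have : tspow q N b <= tspow q N (a - h) + lip_cst q * N `^ q * `|a - b - h|.
  rewrite -lerBlDl; apply: le_trans (ler_norm _) _.
  apply: le_trans (tspow_lip _ _ q0 N0) _.
  by rewrite distrC (_ : a - b - h = a - h - b) //; ring.
set e := lip_cst q * N `^ q * _ => He.
set K := (1 + C) * (1 + B `^ q) * (`|a| `^ q + 1).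
have HK1 : C * (`|a| `^ q + B `^ q) <= K.
  have : 0 <= C * (1 + `|a| `^ q * B `^ q).
    by rewrite mulr_ge0// addr_ge0// mulr_ge0.
  have : 0 <= (1 + B `^ q) * (`|a| `^ q + 1) by rewrite mulr_ge0 ?addr_ge0.
  by rewrite /K; lra.
have HK2 : `|a| `^ q <= K.
  have : 0 <= C * ((1 + B `^ q) * (`|a| `^ q + 1)).
    by rewrite mulr_ge0// mulr_ge0// addr_ge0.
  have : 0 <= B `^ q * (`|a| `^ q + 1) by rewrite mulr_ge0 ?addr_ge0.
  by rewrite /K; lra.
suff : (Num.max 0 (Num.min h L) / 2) `^ (q + 1) + tspow q N (a - h) <=
  tspow q N a + K by lra.
(* For h <= 0 the truncated positive part vanishes, and the argument rises by - h <= B only. *)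
have [h0|h0] := leP h 0.
  rewrite max_l; last by case: (leP h L) => ?; lra.
  rewrite mul0r powR0 ?add0r; last by apply/eqP; lra.
  have vB : - h <= B by lra.
  have v0 : 0 <= - h by lra.
  have := tspow_rise a q0 N0 v0 vB.
  rewrite -/C; lra.
set u := Num.min h L.
have u0 : 0 <= u by rewrite /u; case: (leP h L) => ?; lra.
have uL : u <= L by rewrite /u; case: (leP h L) => ?; lra.
have uh : u <= h by rewrite /u; case: (leP h L) => ?; lra.
rewrite max_r//.
have Hm : tspow q N (a - h) <= tspow q N (a - u) by rewrite tspow_le//; lra.
(* As u <= L <= N / 2, both [a] and [a - u] then lie in [- N, N], where clamping changes nothing. *)
have [aN|aN] := leP `|a| (N / 2).
  have := spow_drop a q0 u0.
  have -> : spow q a = tspow q N a by rewrite /tspow clamp_id//; lra.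
  have -> : spow q (a - u) = tspow q N (a - u).
    rewrite /tspow clamp_id//; apply: le_trans (ler_normB _ _) _.
    by rewrite (ger0_norm u0); lra.
  lra.
(* For |a| > N / 2 clamping may hide the drop, but [N] is so large that |a| ^ q alone dominates the
   left-hand side. *)
have : (u / 2) `^ (q + 1) <= `|a| `^ q.
  apply: (@le_trans _ _ (L `^ (q + 1))); first by apply: ler_powRl; lra.
  by apply: le_trans LN _; apply: ler_powRl; lra.
have : tspow q N (a - u) <= tspow q N a by rewrite tspow_le//; lra.
lra.
Qed.

End Signed_power.

(** * Transfer functions of functions that are bounded below *)

Section Measurability.
Context {R : realType} d (X : measurableType d).

Lemma measurable_powR_norm (f : X -> R) q : measurable_fun setT f ->
  measurable_fun setT (fun x => `|f x| `^ q).
Proof.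
move=> mf; apply: (measurableT_comp (measurable_powR q)).
exact: measurableT_comp.
Qed.

End Measurability.

Lemma measurable_tspow (R : realType) (q N : R) :
  measurable_fun [set: R] (tspow q N).
Proof.
have mc : measurable_fun [set: R] (clamp N).
  by apply: measurable_maxr => //; apply: measurable_minr.
by apply: measurable_funM => //; exact: measurable_powR_norm.
Qed.

(** * Integration of the pointwise estimate along a measure preserving map *)

Section Coboundary_estimate.
Context {R : realType} d (X : measurableType d) (mu : probability X R).
Implicit Types (f g h u v : X -> R) (T : X -> X).

Lemma ge0_integral_measure_preserving T (F : X -> \bar R) :
  measure_preserving mu T -> measurable_fun setT F -> (forall x, 0 <= F x)%E ->
  (\int[mu]_x F (T x) = \int[mu]_x F x)%E.
Proof.
move=> [mT muT] mF F0.
have := @ge0_integral_pushforward _ _ _ _ R T mT mu setT F measurableT mF.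
rewrite preimage_setT => <-; last by move=> x _; exact: F0.
by apply: eq_measure_integral => A mA _; exact: muT.
Qed.

(** The integrals of psi (g) and psi (g o T) are equal by invariance and finite by boundedness of
    [psi], so they cancel even if [g] is not integrable. *)
Lemma integral_coboundary_le (psi : R -> R) (M : R) u v g T :
  measurable_fun setT psi -> (forall a, 0 <= psi a) -> (forall a, psi a <= M) ->
  measurable_fun setT u -> (forall x, 0 <= u x) ->
  measurable_fun setT v -> (forall x, 0 <= v x) ->
  measurable_fun setT g -> measure_preserving mu T ->
  {ae mu, forall x, u x + psi (g (T x)) <= v x + psi (g x)} ->
  (\int[mu]_x (u x)%:E <= \int[mu]_x (v x)%:E)%E.
Proof.
move=> mpsi psi0 psiM mu' u0 mv v0 mg mpT uv.
have mgT : measurable_fun setT (g \o T) by exact: measurableT_comp mpT.1.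
have mpg : measurable_fun setT (EFin \o (psi \o g)).
  by apply/measurable_EFinP; exact: measurableT_comp.
have mpgT : measurable_fun setT (EFin \o (psi \o (g \o T))).
  by apply/measurable_EFinP; exact: measurableT_comp.
move/measurable_EFinP : mu' => mu'; move/measurable_EFinP : mv => mv.
pose J := (\int[mu]_x (psi (g x))%:E)%E.
have JT : (\int[mu]_x (psi (g (T x)))%:E = J)%E.
  rewrite (ge0_integral_measure_preserving mpT
    (F := fun x => (psi (g x))%:E))//.
  by move=> x; rewrite lee_fin.
have Jfin : J \is a fin_num.
  rewrite ge0_fin_numE; last by apply: integral_ge0 => x _; rewrite lee_fin.
  apply: (@le_lt_trans _ _ (\int[mu]_x (cst M%:E x))%E).
    apply: ge0_le_integral; [by []| |exact: mpg|exact: measurable_cst|].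
    - by move=> x _; rewrite lee_fin.
    - by move=> x _; rewrite lee_fin.
  by rewrite integral_cst//= probability_setT mule1 ltry.
rewrite -(leeD2rE _ _ Jfin) -{1}JT.
rewrite -ge0_integralD//; last 2 first.
- by move=> x _; rewrite lee_fin.
- by move=> x _; rewrite lee_fin.
rewrite -ge0_integralD//; last 2 first.
- by move=> x _; rewrite lee_fin.
- by move=> x _; rewrite lee_fin.
apply: ae_ge0_le_integral.
- by [].
- by move=> x _; rewrite lee_fin addr_ge0.
- exact: emeasurable_funD.
- by move=> x _; rewrite lee_fin addr_ge0.
- exact: emeasurable_funD.
- by apply: filterS uv => x uvx _; rewrite lee_fin.
Qed.

(** A level [N] meeting both constraints of [tspow_coboundary]; the sum stands in for a maximum. *)
Definition trunc_level q L : R := 2 * (L + (L `^ (q + 1)) `^ q^-1).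

Lemma trunc_level_ge q L : 0 < q -> 0 <= L ->
  2 * L <= trunc_level q L /\ L `^ (q + 1) <= (trunc_level q L / 2) `^ q.
Proof.
move=> q0 L0; rewrite /trunc_level.
have H : 0 <= (L `^ (q + 1)) `^ q^-1 by exact: powR_ge0.
split; first lra.
apply: (@le_trans _ _ (((L `^ (q + 1)) `^ q^-1) `^ q)).
  by rewrite -powRrM mulVf ?gt_eqF// powRr1// powR_ge0.
by apply: ler_powRl => //; lra.
Qed.

Definition neg_cst q B : R := (1 + lip_cst q * B * 2 `^ q) * (1 + B `^ q).

Lemma neg_cst_ge0 q B : 0 <= B -> 0 <= neg_cst q B.
Proof.
by move=> B0; rewrite mulr_ge0 ?addr_ge0 ?mulr_ge0 ?powR_ge0 ?ler0n.
Qed.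

(** The coefficient of the integral of |g| ^ q is independent of [L]; only that of the distance from
    [f] to [h] grows with [L], and this distance can be made small after [L] is fixed. *)
Lemma integral_truncation_le q B L f g h T :
  0 < q -> 0 <= B -> 0 <= L ->
  measurable_fun setT f -> measurable_fun setT g -> measurable_fun setT h ->
  (forall x, - B <= h x) ->
  measure_preserving mu T -> {ae mu, forall x, f x = g x - g (T x)} ->
  (\int[mu]_x ((Num.max 0 (Num.min (h x) L) / 2) `^ (q + 1))%:E <=
   (neg_cst q B)%:E * (\int[mu]_x (`|g x| `^ q)%:E + 1) +
   (lip_cst q * trunc_level q L `^ q)%:E * \int[mu]_x `|f x - h x|%:E)%E.
Proof.
move=> q0 B0 L0 mf mg mh hB mpT fg.
have [NL LN] := trunc_level_ge q0 L0.
set N := trunc_level q L in NL LN *; set D := lip_cst q * N `^ q.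
have N0 : 0 <= N by lra.
have D0 : 0 <= D by rewrite mulr_ge0 ?ler0n ?powR_ge0.
have C0 : 0 <= neg_cst q B by exact: neg_cst_ge0.
set C := neg_cst q B in C0 *.
have mu' : measurable_fun setT
    (fun x => (Num.max 0 (Num.min (h x) L) / 2) `^ (q + 1)).
  apply: (measurableT_comp (measurable_powR (q + 1))).
  apply: measurable_funM => //; apply: measurable_maxr => //.
  exact: measurable_minr.
have mgq : measurable_fun setT (fun x => `|g x| `^ q).
  exact: measurable_powR_norm.
have mgq1 : measurable_fun setT (fun x => `|g x| `^ q + 1).
  exact: measurable_funD.
have mfh : measurable_fun setT (fun x => `|f x - h x|).
  by apply: measurableT_comp => //; exact: measurable_funB.
have mCg : measurable_fun setT (fun x => C * (`|g x| `^ q + 1)).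
  exact: measurable_funM.
have mDf : measurable_fun setT (fun x => D * `|f x - h x|).
  exact: measurable_funM.
have gq0 x : 0 <= `|g x| `^ q by exact: powR_ge0.
have gq10 x : 0 <= `|g x| `^ q + 1 by exact: addr_ge0.
have mgqE : measurable_fun setT (fun x => (`|g x| `^ q)%:E).
  by apply/measurable_EFinP.
have cst1 : (\int[mu]_(x in setT) cst 1%E x = 1)%E.
  by rewrite integral_cst//= probability_setT mule1.
have -> : (\int[mu]_x (`|g x| `^ q)%:E + 1 = \int[mu]_x (`|g x| `^ q + 1)%:E)%E.
  by rewrite -[X in (_ + X)%E]cst1 -ge0_integralD.
rewrite -ge0_integralZl//; do ?exact/measurable_EFinP.
rewrite -ge0_integralZl//; do ?exact/measurable_EFinP.
rewrite -ge0_integralD//; last 4 first.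
- by move=> x _; rewrite lee_fin mulr_ge0.
- exact/measurable_EFinP.
- by move=> x _; rewrite lee_fin mulr_ge0.
- exact/measurable_EFinP.
have H a : - (N * N `^ q) <= tspow q N a <= N * N `^ q.
  by rewrite -ler_norml; exact: tspow_bound.
(* Adding the bound N * N ^ q makes the test function nonnegative, as [integral_coboundary_le]
   requires. *)
apply: (@integral_coboundary_le (fun a => tspow q N a + N * N `^ q)
  (N * N `^ q + N * N `^ q) _
  (fun x => C * (`|g x| `^ q + 1) + D * `|f x - h x|) g T) => //.
- by apply: measurable_funD => //; exact: measurable_tspow.
- by move=> a; have /andP[] := H a; lra.
- by move=> a; have /andP[] := H a; lra.
- by move=> x; exact: powR_ge0.
- exact: measurable_funD.
- by move=> x; rewrite addr_ge0// mulr_ge0.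
- apply: filterS fg => x fgx.
  have := tspow_coboundary (g x) (g (T x)) q0 B0 L0 (hB x) LN NL.
  by rewrite -fgx -/(neg_cst q B) -/C -/D; lra.
Qed.

End Coboundary_estimate.

(** * Stability of the lower bound on transfer functions *)

Section Large_transfer.
Context {R : realType} d (X : measurableType d) (mu : probability X R).
Implicit Types (f g h u : X -> R) (T : X -> X).

Lemma measurable_pos_powR h r : measurable_fun setT h ->
  measurable_fun setT (fun x => (Num.max 0 (h x)) `^ r).
Proof.
move=> mh; apply: (measurableT_comp (measurable_powR r)).
exact: measurable_maxr.
Qed.

Lemma integral_pos_half h r : measurable_fun setT h ->
  (\int[mu]_x ((Num.max 0 (h x)) `^ r)%:E = +oo)%E ->
  (\int[mu]_x ((Num.max 0 (h x) / 2) `^ r)%:E = +oo)%E.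
Proof.
move=> mh hoo.
under eq_integral.
  move=> x _; rewrite powRM ?le_max ?lexx ?invr_ge0// mulrC EFinM; over.
rewrite ge0_integralZl//; last 2 first.
- exact/measurable_EFinP/measurable_pos_powR.
- by move=> x _; rewrite lee_fin powR_ge0.
by rewrite hoo gt0_muley// lte_fin powR_gt0// invr_gt0.
Qed.

(** Monotone convergence along the integer truncation levels. *)
Lemma integral_truncation_gt h r (A : R) : 0 < r -> measurable_fun setT h ->
  (\int[mu]_x ((Num.max 0 (h x) / 2) `^ r)%:E = +oo)%E ->
  exists2 L : R, 0 <= L &
    (A%:E < \int[mu]_x ((Num.max 0 (Num.min (h x) L) / 2) `^ r)%:E)%E.
Proof.
move=> r0 mh hoo.
pose u (n : nat) x := ((Num.max 0 (Num.min (h x) n%:R) / 2) `^ r)%:E.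
have mu_ n : measurable_fun setT (u n).
  apply/measurable_EFinP; apply: (measurableT_comp (measurable_powR r)).
  apply: measurable_funM => //; apply: measurable_maxr => //.
  exact: measurable_minr.
have u0 n x : setT x -> (0 <= u n x)%E by move=> _; rewrite lee_fin powR_ge0.
have nd_u x : setT x -> {homo u ^~ x : n m / (n <= m)%N >-> (n <= m)%E}.
  move=> _ n m nm; rewrite lee_fin; apply: ler_powRl => //.
    by rewrite divr_ge0// le_max lexx.
  by rewrite ler_wpM2r ?invr_ge0// le_max2// le_min2// ler_nat.
have : (fun n => \int[mu]_x u n x)%E @ \oo --> +oo%E.
  rewrite [X in _ --> X](_ : _ = \int[mu]_x limn (u ^~ x))%E.
    exact: (cvg_monotone_convergence measurableT mu_ u0 nd_u).
  rewrite -hoo; apply: eq_integral => x _.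
  apply/esym/cvg_lim => //; apply: cvg_near_cst.
  near=> n; rewrite /u min_l//.
  near: n; exact: nbhs_infty_ger.
move=> /cvgeyPgt/(_ A)[n _ /(_ n (leqnn n)) Hn].
by exists n%:R.
Unshelve. all: by end_near. Qed.

Lemma integral_transfer_gt q h (K B : R) : 0 < q -> measurable_fun setT h ->
  (forall x, - B <= h x) ->
  (\int[mu]_x ((Num.max 0 (h x)) `^ (q + 1))%:E = +oo)%E ->
  exists2 e : R, 0 < e & forall f g T,
    measurable_fun setT f -> measurable_fun setT g -> measure_preserving mu T ->
    {ae mu, forall x, f x = g x - g (T x)} ->
    (\int[mu]_x `|f x - h x|%:E <= e%:E)%E ->
    (K%:E < \int[mu]_x (`|g x| `^ q)%:E)%E.
Proof.
move=> q0 mh hB hoo.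
wlog B0 : B hB / 0 <= B.
  move=> /(_ (Num.max 0 B)); apply; last by rewrite le_max lexx.
  by move=> x; apply: le_trans (hB x); rewrite lerN2 le_max lexx orbT.
have q10 : 0 < q + 1 by lra.
(* If the integral of |g| ^ q is at most [K], the estimate allows neg_cst * (K + 1) plus the error
   term; the last 1 is room for that error. *)
have [L L0 AL] := integral_truncation_gt (neg_cst q B * (K + 1) + 1) q10 mh
  (integral_pos_half mh hoo).
set D := lip_cst q * trunc_level q L `^ q.
have D0 : 0 <= D by rewrite mulr_ge0 ?ler0n ?powR_ge0.
(* This radius keeps the error term D * e below 1. *)
exists (D + 1)^-1; first by rewrite invr_gt0; lra.
move=> f g T mf mg mpT fg fh; rewrite ltNge; apply/negP => gK.
have := integral_truncation_le q0 B0 L0 mf mg mh hB mpT fg.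
rewrite leNgt => /negP; apply; apply: le_lt_trans AL; rewrite EFinD.
apply: leeD.
  rewrite [leRHS]EFinM; apply: lee_wpmul2l; last by rewrite EFinD leeD2r.
  by rewrite lee_fin neg_cst_ge0.
apply: (@le_trans _ _ (D%:E * (D + 1)^-1%:E)%E).
  by apply: lee_wpmul2l; rewrite ?lee_fin.
rewrite -EFinM lee_fin ler_pdivrMr; lra.
Qed.

(** Instead of Hölder's inequality, the pointwise bound |u| <= e + e * (|u| / e) ^ p is integrated;
    each summand contributes at most [e]. *)
Lemma integral_norm_le p (e : R) u : 1 <= p -> 0 < e -> measurable_fun setT u ->
  ('N[mu]_p%:E[EFin \o u] <= e%:E)%E ->
  (\int[mu]_x `|u x|%:E <= (2 * e)%:E)%E.
Proof.
move=> p1 e0 mu' Ne; have p0 : 0 < p by lra.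
have mup := measurable_powR_norm p mu'.
have up0 x : 0 <= `|u x| `^ p by exact: powR_ge0.
have Ip : (\int[mu]_x (`|u x| `^ p)%:E <= (e `^ p)%:E)%E.
  have -> : (\int[mu]_x (`|u x| `^ p)%:E = 'N[mu]_p%:E[EFin \o u] `^ p)%E.
    by rewrite poweR_Lnorm ?gt_eqF//; apply: eq_integral.
  rewrite -poweR_EFin; apply: gt0_ler_poweR => //; first exact: ltW.
  - by rewrite in_itv/= Lnorm_ge0 leey.
  - by rewrite in_itv/= lee_fin leey ltW.
pose c := e / e `^ p.
have c0 : 0 <= c by rewrite divr_ge0 ?powR_ge0// ltW.
have pw x : `|u x| <= e + c * `|u x| `^ p.
  have [ue|/ltW ue] := leP `|u x| e.
    by apply: le_trans ue _; rewrite lerDl mulr_ge0.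
  have : `|u x| / e <= (`|u x| / e) `^ p.
    by apply: le1r_powR => //; rewrite ler_pdivlMr// mul1r.
  have -> : (`|u x| / e) `^ p = `|u x| `^ p * (e `^ p)^-1.
    have eV : e^-1 `^ p = (e `^ p)^-1.
      by rewrite -(powR_inv1 (ltW e0)) -powRrM mulN1r powRN.
    by rewrite powRM ?eV// invr_ge0 ltW.
  rewrite ler_pdivrMr// /c; lra.
apply: (@le_trans _ _ (\int[mu]_x (cst e%:E x + (c * `|u x| `^ p)%:E))%E).
  apply: ge0_le_integral => //.
  - by apply/measurable_EFinP; exact: measurableT_comp.
  - apply: emeasurable_funD => //; apply/measurable_EFinP.
    exact: measurable_funM.
  - by move=> x _; rewrite -EFinD lee_fin.
rewrite ge0_integralD//; last 3 first.
- by move=> x _; rewrite lee_fin ltW.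
- by move=> x _; rewrite lee_fin mulr_ge0.
- by apply/measurable_EFinP; exact: measurable_funM.
rewrite integral_cst//= probability_setT mule1.
under eq_integral do rewrite EFinM.
rewrite ge0_integralZl//; last exact/measurable_EFinP.
rewrite mulrDl mul1r EFinD leeD2l//.
apply: (@le_trans _ _ (c%:E * (e `^ p)%:E)%E); first exact: lee_wpmul2l.
by rewrite -EFinM lee_fin /c divfK// gt_eqF// powR_gt0.
Qed.

End Large_transfer.

(** * Functions in L^p and in no L^r with r > p *)

Section Small_sets.
Context {R : realType} d (X : measurableType d) (mu : probability X R).

(** The set is the preimage of the part of [B] inside [Y0]; the rest of [B] is null, being contained
    in D \ Y0. *)
Lemma iso_mod0_preimage d2 (Y : measurableType d2)
    (nu : {measure set Y -> \bar R}) (D B : set Y) :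
  iso_mod0 mu nu D -> measurable D -> measurable B -> B `<=` D ->
  exists2 A, measurable A & mu A = nu B.
Proof.
move=> [X0 [Y0 [phi [psi [[mX0 _ mY0 Y0D nuD] [_ [mphi _ muphi]]]]]]] mD mB BD.
exists (X0 `&` phi @^-1` (B `&` Y0)).
  by apply: mphi => //; exact: measurableI.
rewrite muphi//; last exact: measurableI.
rewrite [RHS](measureDI nu mB mY0).
rewrite [X in _ = (X + _)%E](_ : _ = 0%E) ?add0e//.
apply/eqP; rewrite eq_le measure_ge0 andbT -nuD.
by apply: le_measure; rewrite ?inE;
  [exact: measurableD|exact: measurableD|exact: setSD].
Qed.

(** The interval [0, min (e, 1)] is pulled back; it is measurable in both the Borel and the Lebesgue
    case. *)
Lemma standard_small_sets (e : R) : standard_probability_space mu -> 0 < e ->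
  exists A, [/\ measurable A, (0 < mu A)%E & (mu A <= e%:E)%E].
Proof.
move=> hX e0; pose m := Num.min e 1.
have m0 : 0 < m by rewrite lt_min e0 ltr01.
have m1 : m <= 1 by rewrite ge_min lexx orbT.
pose B : set R := `[0, m]%classic.
have BD : B `<=` `[0, 1]%classic.
  by move=> x; rewrite /B/= !in_itv/= => /andP[-> xm]; exact: le_trans m1.
have leb : (lebesgue_measure B = m%:E)%E.
  by rewrite lebesgue_measure_itv/= lte_fin m0 oppr0 adde0.
suff [A mA muA] : exists2 A, measurable A & mu A = m%:E.
  by exists A; rewrite muA lte_fin lee_fin m0 ge_min lexx.
rewrite -leb; case: hX => [h|h].
  by apply: (iso_mod0_preimage h) => //; exact: measurable_itv.
by apply: (iso_mod0_preimage h) => //; apply: sub_caratheodory;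
  exact: measurable_itv.
Qed.

End Small_sets.

(** * An integrable function with no higher integrability *)

Section Singular_function.
Context {R : realType} d (X : measurableType d) (mu : probability X R).

(* [F] is the sum of the [c k * \1_(A k)], with [c k * mu (A k) = 2 ^ - (k + 1)]
   and [mu (A k)] decreasing so fast that [c k ^ (r - 1)] exceeds
   [(k + 1) * 2 ^ (k + 1)] as soon as [k * (r - 1) >= 1]. *)
Lemma exists_singular :
  (forall e : R, 0 < e ->
    exists A, [/\ measurable A, (0 < mu A)%E & (mu A <= e%:E)%E]) ->
  exists F : X -> R, [/\ measurable_fun setT F, forall x, 0 <= F x,
    (\int[mu]_x (F x)%:E < +oo)%E &
    forall r, 1 < r -> (\int[mu]_x (F x `^ r)%:E = +oo)%E].
Proof.
move=> small.
pose w (k : nat) : R := (2 ^ k.+1)%:R.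
have w0 k : 0 < w k by rewrite ltr0n expn_gt0.
have w1 k : 1 <= w k by rewrite ler1n expn_gt0.
pose b (k : nat) : R := k.+1%:R * w k.
have b1 k : 1 <= b k.
  by rewrite -[leLHS]mul1r ler_pM// ler1n.
have b0 k : 0 < b k by apply: lt_le_trans (b1 k).
have bk0 k : 0 < b k `^ k%:R by rewrite powR_gt0.
have /choice[A HA] : forall k, exists A, [/\ measurable A, (0 < mu A)%E &
    (mu A <= ((w k * b k `^ k%:R)^-1)%:E)%E].
  by move=> k; apply: small; rewrite invr_gt0 mulr_gt0.
have mA k : measurable (A k) by have [] := HA k.
pose m k : R := fine (mu (A k)).
have muA k : mu (A k) = (m k)%:E by rewrite fineK// fin_num_measure.
have m0 k : 0 < m k by have [_ + _] := HA k; rewrite muA lte_fin.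
have mle k : m k <= (w k * b k `^ k%:R)^-1.
  by have [_ _ +] := HA k; rewrite muA lee_fin.
pose c k := (w k * m k)^-1.
have c0 k : 0 < c k by rewrite invr_gt0 mulr_gt0.
have cb k : b k `^ k%:R <= c k.
  rewrite /c -[leLHS]invrK lef_pV2 ?posrE ?invr_gt0 ?mulr_gt0//.
  by rewrite -ler_pdivlMl// -invfM.
have cm k : c k * m k = 1 / w k.
  by rewrite /c invfM mul1r -mulrA mulVf ?mulr1// gt_eqF.
pose t k x : \bar R := (c k * \1_(A k) x)%:E.
have t0 k x : setT x -> (0 <= t k x)%E.
  by move=> _; rewrite lee_fin mulr_ge0// ltW.
have mt k : measurable_fun setT (t k).
  by apply/measurable_EFinP; apply: measurable_funM => //;
    exact: measurable_indic.
pose G x := (\sum_(k <oo) t k x)%E.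
have mG : measurable_fun setT G.
  apply: (@ge0_emeasurable_sum _ _ _ setT t xpredT) => //.
  by move=> k x _ _; exact: t0.
have G0 x : (0 <= G x)%E by apply: nneseries_ge0 => n _ _; exact: t0.
have It k : (\int[mu]_x t k x = (1 / w k)%:E)%E.
  under eq_integral do rewrite /t EFinM.
  rewrite ge0_integralZl//; last first.
  - by rewrite lee_fin ltW.
  - by apply/measurable_EFinP; exact: measurable_indic.
  by rewrite integral_indic// setIT [X in (_ * X)%E](muA k) -EFinM cm.
have IG : (\int[mu]_x G x < +oo)%E.
  rewrite integral_nneseries//; under eq_eseriesr do rewrite It.
  by apply: le_lt_trans (epsilon_trick0 xpredT ler01) _; rewrite ltry.
have Gfin : {ae mu, forall x, G x \is a fin_num}.
  have : mu.-integrable setT G.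
    by apply/integrableP; split => //; under eq_integral do rewrite gee0_abs//.
  by move/(integrable_ae measurableT); apply: filterS => x; apply.
(* [fine] sends +oo to 0, which affects only a null set because [G] is integrable. *)
pose F x := fine (G x).
have F0 x : 0 <= F x by rewrite fine_ge0.
have mF : measurable_fun setT F by exact: measurableT_comp.
exists F; split => //.
  apply: le_lt_trans IG; apply: ge0_le_integral => //.
  - by move=> x _; rewrite lee_fin.
  - exact/measurable_EFinP.
  - by move=> x _; rewrite /F; case: (G x) (G0 x) => [s||]//= _; rewrite leey.
move=> r r1; have r0 : 0 < r by lra.
(* The k-th term alone suffices: c ^ r * m = c ^ (r - 1) / w, and c >= b ^ k together with k * (r -
   1) >= 1 makes this at least b / w = k + 1. *)
suff key (k : nat) : 1 <= k%:R * (r - 1) ->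
    (k%:R%:E <= \int[mu]_x (F x `^ r)%:E)%E.
  apply/eqyP => M _.
  pose k := maxn (Num.truncn M).+1 (Num.truncn (r - 1)^-1).+1.
  have kM : M <= k%:R.
    apply: (@le_trans _ _ (Num.truncn M).+1%:R); first exact/ltW/truncnS_gt.
    by rewrite ler_nat leq_maxl.
  have kr : (r - 1)^-1 <= k%:R.
    apply: (@le_trans _ _ (Num.truncn (r - 1)^-1).+1%:R).
      exact/ltW/truncnS_gt.
    by rewrite ler_nat leq_maxr.
  apply: le_trans (key k _); first by rewrite lee_fin.
  by rewrite -ler_pdivrMr ?subr_gt0// mul1r.
move=> kr.
apply: (@le_trans _ _ (\int[mu]_x ((c k `^ r)%:E * (\1_(A k) x)%:E))%E).
  rewrite ge0_integralZl//; last first.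
  - by rewrite lee_fin powR_ge0.
  - by apply/measurable_EFinP; exact: measurable_indic.
  rewrite integral_indic// setIT [X in (_ * X)%E](muA k) -EFinM lee_fin.
  have -> : c k `^ r * m k = (w k)^-1 * c k `^ (r - 1).
    rewrite -(mulr_powRB1 (ltW (c0 k)) r0) mulrAC cm div1r.
    by [].
  rewrite -ler_pdivrMl ?invr_gt0// invrK.
  apply: (@le_trans _ _ (b k)).
    by rewrite /b mulrC ler_wpM2r ?ler_nat// ltW.
  apply: (@le_trans _ _ ((b k `^ k%:R) `^ (r - 1))); last first.
    by apply: ler_powRl => //; rewrite ?subr_gt0 ?powR_ge0.
  by rewrite -powRrM le1r_powR.
apply: ae_ge0_le_integral => //.
- by move=> x _; rewrite -EFinM lee_fin mulr_ge0// powR_ge0.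
- by apply: emeasurable_funM => //; apply/measurable_EFinP;
    exact: measurable_indic.
- by move=> x _; rewrite lee_fin powR_ge0.
- apply/measurable_EFinP; exact: (measurableT_comp (measurable_powR r)).
apply: filterS Gfin => x Gx _; rewrite -EFinM lee_fin indicE.
have [xA|xA] := boolP (x \in A k); last by rewrite mulr0 powR_ge0.
rewrite mulr1; apply: ler_powRl => //; first exact: ltW.
rewrite /F -lee_fin fineK//.
have <- : t k x = (c k)%:E by rewrite /t indicE xA mulr1.
rewrite /G (nneseriesD1 (n := k))//; last by move=> i _; exact: t0.
by rewrite leeDl// nneseries_ge0// => i _ _; exact: t0.
Qed.

End Singular_function.

(** * Density *)

Section Density.
Context {R : realType} d (X : measurableType d) (mu : probability X R).
Implicit Types (f g h s u v : X -> R).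

Lemma Lfun_measurable p f : f \in Lfun mu p -> measurable_fun setT f.
Proof. by move=> /sub_Lfun_mfun; rewrite inE. Qed.

Lemma Lfun_dominated p f v : 0 < p -> measurable_fun setT f ->
  v \in Lfun mu p%:E -> (forall x, `|f x| <= `|v x|) -> f \in Lfun mu p%:E.
Proof.
move=> p0 mf vp fv; have mv := Lfun_measurable vp.
apply/LqE => //; split => //.
have [_ /=] := (LqE mu v p0).2 vp.
apply: le_lt_trans; apply: ge0_le_integral => //.
- by apply/measurable_EFinP; exact: measurable_powR_norm.
- by apply/measurable_EFinP; exact: measurable_powR_norm.
- by move=> x _; rewrite lee_fin ler_powRl.
Qed.

Lemma Lfun_normr p f : 0 < p -> f \in Lfun mu p%:E ->
  (fun x => `|f x|) \in Lfun mu p%:E.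
Proof.
move=> p0 fp; have mf := Lfun_measurable fp.
apply: (Lfun_dominated p0 _ fp); first exact: measurableT_comp.
by move=> x; rewrite normr_id.
Qed.

Lemma cvg0_powR (u : R^nat) p : 1 <= p -> u @ \oo --> 0 ->
  `|u n| `^ p @[n --> \oo] --> 0.
Proof.
move=> p1 /cvgr0Pnorm_lt u0; apply/cvgr0Pnorm_lt => e e0; near=> n.
have ue : `|u n| < e by near: n; exact: u0.
have u1 : `|u n| < 1 by near: n; exact: u0.
rewrite ger0_norm ?powR_ge0//; apply: le_lt_trans ue.
have [->|un0] := eqVneq `|u n| 0; first by rewrite powR0//; apply/eqP; lra.
by apply: ge1r_powR => //; rewrite lt_def un0 normr_ge0/= ltW.
Unshelve. all: by end_near. Qed.

(** Were the positive part of [h] in L^r, so would be [s], since constants are integrable for a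
    probability. *)
Lemma integral_pos_singular s h (r a K : R) : 0 < r -> 0 <= a -> 0 <= K ->
  measurable_fun setT s -> measurable_fun setT h -> (forall x, 0 <= s x) ->
  (forall x, s x <= a * (Num.max 0 (h x) + K)) ->
  (\int[mu]_x (s x `^ r)%:E = +oo)%E ->
  (\int[mu]_x (Num.max 0 (h x) `^ r)%:E = +oo)%E.
Proof.
move=> r0 a0 K0 ms mh s0 sh soo; apply/eqP; rewrite -leye_eq leNgt.
apply/negP => hfin.
have mhr := measurable_pos_powR r mh.
have mE : measurable_fun setT (fun x => (Num.max 0 (h x) `^ r)%:E).
  by apply/measurable_EFinP.
have pos_ge0 x : 0 <= Num.max 0 (h x) by rewrite le_max lexx.
pose C := a `^ r * 2 `^ r.
have C0 : 0 <= C by rewrite mulr_ge0 ?powR_ge0.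
have pw x : s x `^ r <= C * (Num.max 0 (h x) `^ r + K `^ r).
  apply: (@le_trans _ _ ((a * (Num.max 0 (h x) + K)) `^ r)).
    exact: ler_powRl.
  rewrite powRM ?addr_ge0// /C -mulrA ler_wpM2l ?powR_ge0//.
  exact: powRD_le.
have : (\int[mu]_x (s x `^ r)%:E < +oo)%E; last by rewrite soo ltxx.
apply: (@le_lt_trans _ _
    (\int[mu]_x (C%:E * ((Num.max 0 (h x) `^ r)%:E + cst (K `^ r)%:E x)))%E).
  apply: ge0_le_integral => //.
  - by move=> x _; rewrite lee_fin powR_ge0.
  - apply/measurable_EFinP; exact: (measurableT_comp (measurable_powR r)).
  - by apply: measurable_funeM; exact: emeasurable_funD mE (measurable_cst _).
  - by move=> x _; rewrite -EFinD -EFinM lee_fin.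
rewrite ge0_integralZl//; last 2 first.
- exact: emeasurable_funD mE (measurable_cst _).
- by move=> x _; rewrite -EFinD lee_fin addr_ge0 ?powR_ge0.
rewrite ge0_integralD//; last 2 first.
- by move=> x _; rewrite lee_fin powR_ge0.
- by move=> x _; rewrite lee_fin powR_ge0.
rewrite integral_cst//= probability_setT mule1.
by rewrite lte_mul_pinfty ?lee_fin// lte_add_pinfty// ltry.
Qed.

Lemma bounded_below_dense (p : R) (f s : X -> R) (e : R) : 1 <= p -> 0 < e ->
  f \in Lfun mu p%:E -> (\int[mu]_x (f x)%:E = 0)%E ->
  s \in Lfun mu p%:E -> (forall x, 0 <= s x) ->
  (forall r, p < r -> (\int[mu]_x (s x `^ r)%:E = +oo)%E) ->
  exists h, [/\ h \in Lfun mu p%:E, (\int[mu]_x (h x)%:E = 0)%E,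
    ('N[mu]_p%:E[(fun x => (f x - h x)%:E)] < e%:E)%E,
    exists B, forall x, - B <= h x &
    forall r, p < r -> (\int[mu]_x (Num.max 0 (h x) `^ r)%:E = +oo)%E].
Proof.
move=> p1 e0 fp If sp s0 soo; have p0 : 0 < p by lra.
have mf := Lfun_measurable fp; have ms := Lfun_measurable sp.
pose v x := `|f x| + s x.
have v0 x : 0 <= v x by rewrite addr_ge0.
have vp : v \in Lfun mu p%:E by apply: rpredD => //; exact: Lfun_normr.
(* The first summand lifts [f] to at least [- j]; the second plants a vanishing multiple of the
   singular function. Both tend to 0 and are dominated by [v]. *)
pose u (j : nat) x := Num.max 0 (- f x - j%:R) + s x / j.+1%:R.
have u0 j x : 0 <= u j x by rewrite addr_ge0 ?divr_ge0// le_max lexx.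
have uv j x : u j x <= v x.
  apply: lerD.
    rewrite ge_max normr_ge0/= lerBlDr (le_trans (ler_norm _))// normrN.
    by rewrite lerDl.
  by rewrite ler_pdivrMr// ler_peMr// ler1n.
have mu_ j : measurable_fun setT (u j).
  apply: measurable_funD; last exact: measurable_funM.
  apply: measurable_maxr => //; apply: measurable_funB => //.
  exact: measurable_funN.
have up j : u j \in Lfun mu p%:E.
  apply: (Lfun_dominated p0 (mu_ j) vp) => x.
  by rewrite !ger0_norm.
have ucvg x : u j x @[j --> \oo] --> 0.
  rewrite -[X in _ --> X]addr0; apply: cvgD.
    apply: cvg_near_cst; near=> j; rewrite max_l// lerBlDr add0r.
    near: j; exact: nbhs_infty_ger.
  rewrite -[X in _ --> X](mulr0 (s x)); apply: cvgMr.
  exact: cvg_harmonic.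
have Lfun1 k : k \in Lfun mu p%:E -> mu.-integrable setT (EFin \o k).
  move=> kp; apply/Lfun1_integrable; apply: Lfun_subset kp => //.
  exact: fin_num_measure.
have iv := Lfun1 _ vp.
pose c j := fine (\int[mu]_x (u j x)%:E)%E.
have cE j : (\int[mu]_x (u j x)%:E = (c j)%:E)%E.
  by rewrite fineK//; apply: integrable_fin_num => //; exact: Lfun1.
have c0 j : 0 <= c j.
  by rewrite fine_ge0// integral_ge0// => x _; rewrite lee_fin.
have ccvg : c j @[j --> \oo] --> 0.
  have [//|//|||_ _] := @dominated_convergence _ _ _ mu setT measurableT
    (fun j x => (u j x)%:E) (cst 0%E) (EFin \o v) _ _ _ iv.
  - by move=> j; apply/measurable_EFinP.
  - by apply: nearW => x _; apply: cvg_EFin; [exact: nearW|exact: ucvg].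
  - by apply: nearW => x j _; rewrite lee_fin ger0_norm.
  rewrite integral0 => /fine_cvg; exact.
pose V := fine (\int[mu]_x (v x)%:E)%E.
have VE : (\int[mu]_x (v x)%:E = V%:E)%E.
  by rewrite fineK//; apply: integrable_fin_num.
have cV j : c j <= V.
  rewrite -lee_fin -cE -VE; apply: ge0_le_integral => //.
  - by move=> x _; rewrite lee_fin.
  - exact/measurable_EFinP.
  - by apply/measurable_EFinP; exact: Lfun_measurable vp.
  - by move=> x _; rewrite lee_fin.
have wp : v \+ cst V \in Lfun mu p%:E by apply: rpredD => //; exact: Lfun_cst.
have ucv j x : `|u j x - c j| <= v x + V.
  rewrite (le_trans (ler_normB _ _))// !ger0_norm//; exact: lerD.
pose I j := (\int[mu]_x (`|u j x - c j| `^ p)%:E)%E.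
(* Since c j <= V for all j, the function (v + V) ^ p dominates every integrand. *)
have Icvg : I j @[j --> \oo] --> 0%E.
  have [||||_ _] := @dominated_convergence _ _ _ mu setT measurableT
    (fun j x => (`|u j x - c j| `^ p)%:E) (cst 0%E)
    (fun x => (`|(v \+ cst V) x| `^ p)%:E) _ _ _ (Lfun_integrable p1 wp).
  - move=> j; apply/measurable_EFinP; apply: measurable_powR_norm.
    exact: measurable_funB.
  - exact: measurable_cst.
  - apply: nearW => x _; apply: cvg_EFin; first exact: nearW.
    apply: cvg0_powR => //; rewrite -[X in _ --> X](subr0 0).
    by apply: cvgB; [exact: ucvg|exact: ccvg].
  - apply: nearW => x j _; rewrite lee_fin ger0_norm ?powR_ge0//.
    by apply: ler_powRl => //; rewrite (le_trans (ucv j x))//= ler_norm.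
  by rewrite integral0.
have [j Ij] : exists j, (I j < (e `^ p)%:E)%E.
  have /fine_cvgP[Ifin /cvgr0_norm_lt/(_ (e `^ p))] := Icvg.
  rewrite powR_gt0// => /(_ isT) Ilt.
  near \oo => j; exists j.
  have Ijf : I j \is a fin_num by near: j.
  rewrite -(fineK Ijf) lte_fin (le_lt_trans (ler_norm _))//.
  by near: j.
(* Subtracting the mean [c j] of the correction restores integral 0. *)
pose h x := f x + u j x - c j.
have hp : h \in Lfun mu p%:E.
  have := Lfun_cst mu (c j) p; set k := cst (c j) => kp.
  change (h \in Lfun mu p%:E) with ((f + u j) - k \in Lfun mu p%:E).
  by apply: rpredB => //; exact: rpredD.
have mh := Lfun_measurable hp.
(* This inequality serves twice: it bounds [h] from below since s >= 0, and it bounds [s] by a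
   multiple of the positive part of [h] plus a constant. *)
have hj x : s x / j.+1%:R - j%:R - c j <= h x.
  have : - f x - j%:R <= Num.max 0 (- f x - j%:R) by rewrite le_max lexx orbT.
  by rewrite /h /u; move: (s x / _) (Num.max _ _) => t y; lra.
have sj0 x : 0 <= s x / j.+1%:R by rewrite divr_ge0.
exists h; split => //.
- transitivity (\int[mu]_x ((f x)%:E + ((u j x)%:E - cst (c j)%:E x)))%E.
    by apply: eq_integral => x _; rewrite /h/= -EFinB -EFinD -addrA.
  have iuj := Lfun1 _ (up j).
  have ic : mu.-integrable setT (cst (c j)%:E).
    exact: finite_measure_integrable_cst.
  rewrite integralD//; [|exact: Lfun1|exact: integrableB].
  rewrite integralB// If add0e cE integral_cst//= probability_setT mule1.
  by rewrite subee.
- have NE : ('N[mu]_p%:E[(fun x => (f x - h x)%:E)] `^ p = I j)%E.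
    rewrite poweR_Lnorm ?gt_eqF//; apply: eq_integral => x _ /=.
    have -> : f x - h x = - (u j x - c j).
      by rewrite /h; move: (u j x) => y; ring.
    by rewrite normrN.
  rewrite ltNge; apply/negP => eN; move: Ij; rewrite ltNge => /negP; apply.
  rewrite -NE -poweR_EFin; apply: gt0_ler_poweR => //; first exact: ltW.
  + by rewrite in_itv/= lee_fin leey ltW.
  + by rewrite in_itv/= Lnorm_ge0 leey.
- exists (j%:R + c j) => x; have := hj x; have := sj0 x.
  by move: (s x / _) (h x) => t y; lra.
- move=> r pr; have r0 : 0 < r by lra.
  apply: (@integral_pos_singular s h r j.+1%:R (j%:R + c j)) => //.
  + by rewrite addr_ge0.
  + move=> x; rewrite -ler_pdivrMl ?ltr0n// mulrC.
    have : h x <= Num.max 0 (h x) by rewrite le_max lexx orbT.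
    have := hj x; move: (s x / _) (h x) (Num.max _ _) => t y z; lra.
  + exact: soo.
Unshelve. all: by end_near. Qed.

End Density.

(** * The generic set *)

Section Generic_functions.
Context {R : realType} d (X : measurableType d) (mu : probability X R).
Context (p : R) (p1 : (1 <= p%:E)%E).

(** A sequence decreasing to p - 1, so that countably many exponents handle all q > p - 1; it stays
    positive even when p = 1. *)
Definition transfer_exp (n : nat) : R := p - 1 + n.+1%:R^-1.

(** The bound is the finite number [n] rather than +oo because a finite bound survives small
    perturbations of [f]; membership for all [n] then excludes integrability. *)
Definition large_transfer (n : nat) : set (LfunType mu p1) :=
  [set f | forall T (g : X -> R),
    measure_preserving mu T -> measurable_fun setT g ->
    {ae mu, forall x, f x = g x - g (T x)} ->
    (n%:R%:E < \int[mu]_x (`|g x| `^ transfer_exp n)%:E)%E].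

Lemma transfer_exp_gt0 n : 0 < transfer_exp n.
Proof.
have p1' : 1 <= p by rewrite -lee_fin.
by rewrite ltr_wpDl ?subr_ge0// invr_gt0.
Qed.

Lemma large_transfer_not_integrable (f : LfunType mu p1) :
  (forall n, large_transfer n f) -> no_integrable_transfer mu p f.
Proof.
move=> fU T [mpT _ _] g mg fg q pq [_ gq].
have p1' : 1 <= p by rewrite -lee_fin.
have q0 : 0 < q by lra.
have mgq := measurable_powR_norm q mg.
set I := (\int[mu]_x (`|g x| `^ q)%:E)%E in gq.
have I0 : (0 <= I)%E by apply: integral_ge0 => x _; rewrite lee_fin powR_ge0.
have IE : I = (fine I)%:E by rewrite fineK// ge0_fin_numE.
(* One index does both jobs: its exponent is at most [q], and [n] is at least 1 plus the integral of
   |g| ^ q. This contradicts |g| ^ transfer_exp n <= 1 + |g| ^ q. *)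
pose n := maxn (Num.truncn (q - (p - 1))^-1) (Num.truncn (1 + fine I)).+1.
have nq : transfer_exp n <= q.
  rewrite /transfer_exp -lerBrDl -[leRHS]invrK lef_pV2 ?posrE ?invr_gt0//;
    last lra.
  apply: (@le_trans _ _ (Num.truncn (q - (p - 1))^-1).+1%:R).
    exact/ltW/truncnS_gt.
  by rewrite ler_nat ltnS leq_maxl.
have nI : 1 + fine I <= n%:R.
  apply: (@le_trans _ _ (Num.truncn (1 + fine I)).+1%:R).
    exact/ltW/truncnS_gt.
  by rewrite ler_nat leq_maxr.
have := fU n T g mpT mg fg; rewrite ltNge => /negP; apply.
apply: (@le_trans _ _ (\int[mu]_x (cst 1%E x + (`|g x| `^ q)%:E))%E).
  apply: ge0_le_integral => //.
  - by apply/measurable_EFinP; exact: measurable_powR_norm.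
  - by apply: emeasurable_funD => //; exact/measurable_EFinP.
  - move=> x _; rewrite -EFinD lee_fin.
    have [g1|/ltW g1] := leP `|g x| 1.
      apply: (@le_trans _ _ 1); last by rewrite lerDl powR_ge0.
      have := ler_powRl (transfer_exp_gt0 n) (normr_ge0 (g x)) g1.
      by rewrite powR1.
    apply: (@le_trans _ _ (`|g x| `^ q)); first exact: ler_powR.
    by rewrite lerDr.
rewrite ge0_integralD//; last exact/measurable_EFinP.
by rewrite integral_cst//= probability_setT mule1 -/I IE -EFinD lee_fin.
Qed.

(** As transfer_exp n + 1 > p, the positive part of [h] has infinite integral at that power, and
    [integral_transfer_gt] with K = n gives an L^1 radius; half of it is an L^p radius by
    [integral_norm_le]. *)
Lemma nbhs_large_transfer n (h : LfunType mu p1) (B : R) :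
  (forall x, - B <= h x) ->
  (forall r, p < r -> (\int[mu]_x ((Num.max 0 (h x)) `^ r)%:E = +oo)%E) ->
  nbhs h (large_transfer n).
Proof.
move=> hB hoo.
have p1' : 1 <= p by rewrite -lee_fin.
have mh : measurable_fun setT h by exact: measurable_funPT.
have n0 : 0 < n.+1%:R^-1 :> R by rewrite invr_gt0.
have hoo' : (\int[mu]_x ((Num.max 0 (h x)) `^ (transfer_exp n + 1))%:E = +oo)%E.
  by apply: hoo; rewrite /transfer_exp; move: (_^-1) n0 => t; lra.
have [e e0 He] := integral_transfer_gt n%:R (transfer_exp_gt0 n) mh hB hoo'.
apply/nbhs_ballP; exists (e / 2); first by rewrite /= divr_gt0.
move=> f hf T g mpT mg fg.
have mf : measurable_fun setT f by exact: measurable_funPT.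
apply: (He f g T) => //.
have -> : e = 2 * (e / 2) by rewrite mulrC divfK.
apply: (@integral_norm_le _ _ _ _ p) => //.
- by rewrite divr_gt0.
- exact: measurable_funB.
- exact: ltW (Lp_ball_sym hf).
Qed.

End Generic_functions.

Theorem theorem1p2 (R : realType) (d : measure_display) (X : measurableType d)
    (mu : probability X R) (hX : standard_probability_space mu)
    (p : R) (p1 : (1 <= p%:E)%E) :
  (exists2 f : LfunType mu p1, Lp0 mu p1 f & no_integrable_transfer mu p f) /\
  (exists G : set (Lp0 mu p1),
    [/\ Gdelta G, dense G
      & forall f, G f -> no_integrable_transfer mu p (\val f)]).
Proof.
have p1' : 1 <= p by rewrite -lee_fin.
have p0 : 0 < p by lra.
have [F [mF F0 IF Foo]] := exists_singular (fun e => standard_small_sets hX).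
(* The p-th root moves the critical exponent from 1 to [p]: s ^ r = F ^ (r / p). *)
pose s x := F x `^ p^-1.
have s0 x : 0 <= s x by exact: powR_ge0.
have ms : measurable_fun setT s.
  exact: (measurableT_comp (measurable_powR _)).
have sp : s \in Lfun mu p%:E.
  apply/LqE => //; split => //.
  under eq_integral do rewrite ger0_norm// /s -powRrM mulVf ?gt_eqF// powRr1//.
  exact: IF.
have soo r : p < r -> (\int[mu]_x (s x `^ r)%:E = +oo)%E.
  move=> pr; under eq_integral do rewrite /s -powRrM.
  by apply: Foo; rewrite ltr_pdivlMl// mulr1.
pose G : set (Lp0 mu p1) :=
  \bigcap_n (\val @^-1` (large_transfer (mu := mu) (p1 := p1) n)^°).
have GT (f : Lp0 mu p1) : G f -> no_integrable_transfer mu p (\val f).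
  move=> Gf; apply: large_transfer_not_integrable => n.
  exact: interior_subset (Gf n I).
have Gdense : dense G.
  move=> V [f Vf] [W oW WE].
  have Wf : W (\val f) by rewrite -WE in Vf.
  have /nbhs_ballP[e /= e0 eW] : nbhs (\val f) W by exact: open_nbhs_nbhs.
  have If : (\int[mu]_x ((\val f : LfunType mu p1) x)%:E = 0)%E.
    exact: (set_mem (valP f)).
  (* The same [h], within [e] of [f], is interior to [large_transfer n] for every [n], so the whole
     intersection meets [V]. *)
  have [h [hp Ih fh [B hB] hoo]] :=
    bounded_below_dense p1' e0 (LfunP (\val f : LfunType mu p1)) If sp s0 soo.
  pose k : LfunType mu p1 := Lfun_Sub p1 hp.
  have k0 : Lp0 mu p1 k by exact: Ih.
  exists (SigSub (mem_set k0)); split.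
    rewrite -WE; exact: eW.
  by move=> n _; exact: (@nbhs_large_transfer _ _ _ _ _ _ n k B hB hoo).
split.
  (* The zero function shows that the subspace is inhabited, so density yields a point of [G]. *)
  have zero0 : Lp0 mu p1 (Lfun_Sub p1 (Lfun_cst mu 0 p)).
    exact: integral0.
  have [|f [_ Gf]] := Gdense setT _ openT.
    by exists (SigSub (mem_set zero0)).
  by exists (\val f); [exact: (set_mem (valP f))|exact: GT].
exists G; split => //.
exists (fun n => \val @^-1` (large_transfer (mu := mu) (p1 := p1) n)^°) => // n.
exists (large_transfer (mu := mu) (p1 := p1) n)^° => //.
exact: open_interior.
Qed.
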